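(* Let $A_1=\mathrm{diag}(a_{11},a_{12},a_{13})$ and $A_2=\mathrm{diag}(a_{21},a_{22},a_{23})$ be generic diagonal matrices. Then the algebraic degree (the number of complex critical points) of the heterogeneous quadratics minimization problem $$\min_{Z^TZ=\mathrm{Id}_2}\ Z_1^TA_1Z_1+Z_2^TA_2Z_2,$$ where $Z=[Z_1\,Z_2]$ is a $3\times 2$ matrix of variables with columns $Z_1,Z_2$, is $40$.
   Context: A complex critical point is a matrix $Z\in\mathbb{C}^{3\times 2}$ with $Z^TZ=\mathrm{Id}_2$ such that the gradient of the objective function at $Z$ lies in the linear span of the gradients at $Z$ of the entries of $Z^TZ-\mathrm{Id}_2$; equivalently, there are $q_{11},q_{12},q_{22}\in\mathbb{C}$ with $A_1Z_1=q_{11}Z_1+q_{12}Z_2$ and $A_2Z_2=q_{12}Z_1+q_{22}Z_2$. ''Generic'' means: for all $(a_{ij})$ outside some proper Zariski closed subset of the six-dimensional parameter space. *)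

(* Defs.v *)
From mathcomp Require Import all_boot all_order all_algebra.
From mathcomp Require Import reals.
From mathcomp Require Import complex mpoly.

Set Implicit Arguments.
Unset Strict Implicit.
Unset Printing Implicit Defensive.

Import GRing.Theory.
Local Open Scope ring_scope.

(* Polynomials in the entries of an m x n matrix: the variable attached to
   entry (i, j) is 'X_(mxvec_index i j). *)
Section MatrixPolynomials.
Variables (F : fieldType) (m n : nat).

Definition indet_mx : 'M[{mpoly F[m * n]}]_(m, n) :=
  \matrix_(i, j) 'X_(mxvec_index i j).

Definition eval_at (p : {mpoly F[m * n]}) (Z : 'M[F]_(m, n)) : F :=
  p.@[mxvec Z 0].

Definition gradient (p : {mpoly F[m * n]}) (Z : 'M[F]_(m, n)) : 'M[F]_(m, n) :=
  \matrix_(i, j) eval_at p^`M(mxvec_index i j) Z.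

Definition zariski_closed (V : 'M[F]_(m, n) -> Prop) : Prop :=
  exists S : {mpoly F[m * n]} -> Prop,
    forall x, V x <-> (forall p, S p -> eval_at p x = 0).

Definition generically (P : 'M[F]_(m, n) -> Prop) : Prop :=
  exists V : 'M[F]_(m, n) -> Prop,
    [/\ zariski_closed V, (exists x, ~ V x) & forall x, ~ V x -> P x].

End MatrixPolynomials.

Section HeterogeneousQuadratics.
Variable F : fieldType.
Implicit Types (A : 'M[F]_3) (Z : 'M[F]_(3, 2)).

Definition quadric A (z : 'cV[{mpoly F[3 * 2]}]_3) : {mpoly F[3 * 2]} :=
  (z^T *m map_mx (@mpolyC (3 * 2) F) A *m z) 0 0.

Definition objective A1 A2 : {mpoly F[3 * 2]} :=
  quadric A1 (col 0 (indet_mx F 3 2)) + quadric A2 (col 1 (indet_mx F 3 2)).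

Definition constraint : 'M[{mpoly F[3 * 2]}]_2 :=
  (indet_mx F 3 2)^T *m indet_mx F 3 2 - 1%:M.

Definition critical_point A1 A2 Z : Prop :=
  Z^T *m Z = 1%:M /\
  gradient (objective A1 A2) Z
    \in <<[seq gradient (constraint i j) Z | i <- enum 'I_2, j <- enum 'I_2]>>%VS.

(* Critical points are counted as a set, without multiplicity. *)
Definition algebraic_degree_is A1 A2 (d : nat) : Prop :=
  exists s : seq 'M[F]_(3, 2),
    [/\ uniq s, size s = d & forall Z, Z \in s <-> critical_point A1 A2 Z].

End HeterogeneousQuadratics.

(* Main.v *)
Require Import Defs.
From mathcomp Require Import all_boot all_order all_algebra.
From mathcomp Require Import reals.
From mathcomp Require Import complex mpoly.
From mathcomp Require Import ring.
Set Implicit Arguments.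
Unset Strict Implicit.
Unset Printing Implicit Defensive.
Import GRing.Theory Num.Theory.
Local Open Scope ring_scope.

(** Write x, y for the columns of Z and d, e for the diagonals of the two
matrices.  Criticality says that x, y are orthonormal and that, for some
multipliers a, b, c,
[d_i x_i = a x_i + c y_i] and [e_i y_i = c x_i + b y_i]
(lemma critical_pointP).  All solutions can be written down.

If c = 0, then x and y are unit eigenvectors of diagonal matrices with simple
spectrum, so they are distinct coordinate vectors up to sign: 3 * 2 * 2 * 2 = 24
critical points.

If c <> 0, then no coordinate of x or y vanishes (coordinates_nonzero), and
eliminating y_i gives [(d_i - a) (e_i - b) = c ^ 2] for i = 0, 1, 2: the three
points (d_i, e_i) of the plane lie on a hyperbola with asymptotes parallel to
the axes and centre (a, b).  There is only one such hyperbola through three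
non-collinear points (center_unique), so a, b and c ^ 2 are rational functions
of d and e.  As y_i / x_i = (d_i - a) / c, orthonormality becomes a Vandermonde
system for the squares x_i ^ 2, with a unique solution (weight_unique) which is
again rational in d and e.  So only the signs of c, x_0, x_1, x_2 are free, and
every choice works (hyperbola_critical): 2 ^ 4 = 16 critical points, distinct
from each other and from the first 24.

The argument needs the three points not to be collinear and the entries of each
of d, e and d - e to be pairwise distinct.  The product of the corresponding
polynomials, called discriminant below, is nonzero at one sample point, so it
cuts out a proper Zariski closed set. *)

(** * Gradients and the critical equations *)

Section CriticalEquations.
Variable F : fieldType.

Section GradientCalculus.
Variables (m n : nat) (Z : 'M[F]_(m, n)) (i : 'I_m) (j : 'I_n).
Implicit Types p q : {mpoly F[m * n]}.

Lemma eval_indet k l : eval_at (indet_mx F m n k l) Z = Z k l.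
Proof. by rewrite /eval_at mxE mevalXU mxvecE. Qed.

Lemma gradientD p q :
  gradient (p + q) Z i j = gradient p Z i j + gradient q Z i j.
Proof. by rewrite !mxE /eval_at mderivD mevalD. Qed.

Lemma gradient_sum I r (p : I -> {mpoly F[m * n]}) :
  gradient (\sum_(h <- r) p h) Z i j = \sum_(h <- r) gradient (p h) Z i j.
Proof.
elim/big_rec2: _ => [|h y1 y2 _ <-]; last by rewrite gradientD.
by rewrite mxE /eval_at mderiv0 meval0.
Qed.

Lemma gradientM p q :
  gradient (p * q) Z i j =
  gradient p Z i j * eval_at q Z + eval_at p Z * gradient q Z i j.
Proof. by rewrite !mxE /eval_at mderivM mevalD !mevalM. Qed.

Lemma gradientC c : gradient (c%:MP : {mpoly F[m * n]}) Z i j = 0.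
Proof. by rewrite mxE /eval_at mderivC meval0. Qed.

Lemma gradient_indet k l :
  gradient (indet_mx F m n k l) Z i j = ((k == i) && (l == j))%:R.
Proof.
rewrite mxE /eval_at mxE mderivX mnm1E.
have -> : (mxvec_index k l == mxvec_index i j) = ((k == i) && (l == j)).
  by rewrite /mxvec_index (inj_eq (@cast_ord_inj _ _ _)) (inj_eq enum_rank_inj).
case: eqP => [->|_] /=; last by rewrite scale0r meval0.
case: eqP => [->|_] /=; last by rewrite scale0r meval0.
by rewrite scale1r -{1}[U_(_)%MM]add0m addmK mpolyX0 meval1.
Qed.

End GradientCalculus.

Lemma gradient_constraint (k l : 'I_2) (Z : 'M[F]_(3, 2)) :
  gradient (constraint F k l) Z =
  \matrix_(i, j) ((j == k)%:R * Z i l + (j == l)%:R * Z i k).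
Proof.
apply/matrixP => i j; rewrite [RHS]mxE.
have -> : constraint F k l =
    \sum_h indet_mx F 3 2 h k * indet_mx F 3 2 h l + (- (k == l)%:R)%:MP.
  rewrite /constraint 3!mxE; congr (_ + _).
    by apply: eq_bigr => h _; rewrite mxE.
  by rewrite !mxE mpolyCN mpolyC_nat.
rewrite gradientD gradientC addr0 gradient_sum (bigD1 i) //=.
rewrite big1 => [|h /negPf hi].
  rewrite gradientM !gradient_indet !eval_indet eqxx /= !(eq_sym j); ring.
by rewrite gradientM !gradient_indet hi mul0r mulr0 addr0.
Qed.

Lemma gradient_quadric (d : 'rV[F]_3) k (Z : 'M[F]_(3, 2)) i j :
  gradient (quadric (diag_mx d) (col k (indet_mx F 3 2))) Z i j =
  (j == k)%:R * (2 * (d 0 i * Z i k)).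
Proof.
have -> : quadric (diag_mx d) (col k (indet_mx F 3 2)) =
    \sum_h (d 0 h)%:MP * (indet_mx F 3 2 h k * indet_mx F 3 2 h k).
  rewrite /quadric mxE; apply: eq_bigr => h _.
  by rewrite map_diag_mx mul_mx_diag !mxE mulrAC mulrA mulrC mulrA.
have evalC c : eval_at (c%:MP : {mpoly F[3 * 2]}) Z = c by apply: mevalC.
rewrite gradient_sum (bigD1 i) //= big1 => [|h /negPf hi].
  rewrite !gradientM gradientC !gradient_indet evalC !eval_indet eqxx /=.
  by rewrite (eq_sym j); ring.
by rewrite !gradientM gradientC !gradient_indet hi !(mul0r, mulr0, addr0).
Qed.

Definition critical_equations (d e x y : 'I_3 -> F) : Prop :=
  [/\ \sum_i x i ^+ 2 = 1, \sum_i x i * y i = 0, \sum_i y i ^+ 2 = 1 &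
      exists a b c, forall i,
        d i * x i = a * x i + c * y i /\ e i * y i = c * x i + b * y i].

Lemma ord2P (P : 'I_2 -> Prop) : P 0 -> P 1 -> forall j, P j.
Proof.
move=> P0 P1 [[|[|//]] hj].
  by have -> : Ordinal hj = 0 by apply: val_inj.
by have -> : Ordinal hj = 1 by apply: val_inj.
Qed.

Lemma gradient_objective (d e : 'rV[F]_3) (Z : 'M[F]_(3, 2)) :
  gradient (objective (diag_mx d) (diag_mx e)) Z =
  \matrix_(i, j) (2 * ((if j == 0 then d 0 i else e 0 i) * Z i j)).
Proof.
apply/matrixP => i j; rewrite [RHS]mxE /objective gradientD !gradient_quadric.
by move: j; apply: ord2P; rewrite /= mul1r mul0r ?addr0 ?add0r.
Qed.

(** The four constraint gradients have columns (2 x, 0), (y, x), (y, x) and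
(0, 2 y), so a linear combination of them is exactly a triple of multipliers
(a, b, c) in which c is shared by both columns. *)
Lemma critical_pointP (d e : 'rV[F]_3) (Z : 'M[F]_(3, 2)) : 2 != 0 :> F ->
  critical_point (diag_mx d) (diag_mx e) Z <->
  critical_equations (d 0) (e 0) (Z^~ 0) (Z^~ 1).
Proof.
move=> two0.
have Horth : Z^T *m Z = 1%:M <->
   [/\ \sum_i Z i 0 ^+ 2 = 1, \sum_i Z i 0 * Z i 1 = 0 & \sum_i Z i 1 ^+ 2 = 1].
  have E k l : (Z^T *m Z) k l = \sum_i Z i k * Z i l.
    by rewrite mxE; apply: eq_bigr => i _; rewrite mxE.
  split=> [/matrixP H|[H00 H01 H11]].
    by split; [move: (H 0 0)|move: (H 0 1)|move: (H 1 1)]; rewrite E mxE.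
  apply/matrixP; apply: ord2P; apply: ord2P; rewrite E mxE //=.
  by under eq_bigr do rewrite mulrC.
have Hspan : (gradient (objective (diag_mx d) (diag_mx e)) Z
    \in <<[seq gradient (constraint F i j) Z | i <- enum 'I_2, j <- enum 'I_2]>>%VS)
   <-> exists a b c, forall i,
        d 0 i * Z i 0 = a * Z i 0 + c * Z i 1
        /\ e 0 i * Z i 1 = c * Z i 0 + b * Z i 1.
  have -> : enum 'I_2 = [:: 0; 1].
    rewrite !enum_ordSl (size0nil (size_enum_ord 0)) /=.
    by congr [:: _; _]; apply: val_inj.
  rewrite /allpairs_dep /= !span_cons span_nil addv0.
  rewrite gradient_objective !gradient_constraint.
  split=> [|[a [b [c H]]]].
    move=> /memv_addP[_ /vlineP[k1 ->] [_ /memv_addP[_ /vlineP[k2 ->]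
      [_ /memv_addP[_ /vlineP[k3 ->] [_ /vlineP[k4 ->] ->]] ->]] /matrixP H]].
    (* The gradients of entries (0, 1) and (1, 0) of the constraint coincide,
       and the objective contributes a factor 2. *)
    exists k1, k4, ((k2 + k3) / 2) => i.
    have := H i 0; have := H i 1; rewrite !mxE /= => H1 H0.
    by split; apply: (mulfI two0); rewrite ?H0 ?H1; field.
  have -> : \matrix_(i, j) (2 * ((if j == 0 then d 0 i else e 0 i) * Z i j)) =
    a *: \matrix_(i, j) ((j == 0)%:R * Z i 0 + (j == 0)%:R * Z i 0)
    + (c *: \matrix_(i, j) ((j == 0)%:R * Z i 1 + (j == 1)%:R * Z i 0)
    + (c *: \matrix_(i, j) ((j == 1)%:R * Z i 0 + (j == 0)%:R * Z i 1)
    + b *: \matrix_(i, j) ((j == 1)%:R * Z i 1 + (j == 1)%:R * Z i 1))).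
    apply/matrixP => i; apply: ord2P; rewrite !mxE /=.
      by rewrite (H i).1; ring.
    by rewrite (H i).2; ring.
  by rewrite !memv_add // memvZ // memv_line.
by rewrite /critical_point Horth Hspan; split=> [[[? ? ?] ?]|[]].
Qed.
End CriticalEquations.

(** * The cyclic structure on three indices *)

Lemma cyc3 (i j : 'I_3) : [\/ j = i, j = i + 1 | j = i - 1].
Proof.
by case: i j => [[|[|[|//]]] hi] [[|[|[|//]]] hj];
  first [apply: Or31; exact: val_inj | apply: Or32; exact: val_inj
        | apply: Or33; exact: val_inj].
Qed.

Lemma next_next (i : 'I_3) : i + 1 + 1 = i - 1.
Proof. by case: i => [[|[|[|//]]] hi]; apply: val_inj. Qed.

Lemma prev_prev (i : 'I_3) : i - 1 - 1 = i + 1.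
Proof. by case: i => [[|[|[|//]]] hi]; apply: val_inj. Qed.

(** Expanding around an arbitrary index i, with neighbours i + 1 and i - 1, makes
cyclically symmetric identities polynomial identities in six variables, with no
case analysis on i. *)
Lemma big_cyc3 (T : Type) (idx : T) (op : Monoid.com_law idx) (i : 'I_3) G :
  \big[op/idx]_j G j = op (G i) (op (G (i + 1)) (G (i - 1))).
Proof.
rewrite (bigD1 i) // (bigD1 (i + 1)) /=; last by rewrite eq_sym addrC -subr_eq subrr.
rewrite (big_pred1 (i - 1)) // => j /=.
by case: (cyc3 i j) => ->; case: i => [[|[|[|//]]] hi].
Qed.

(** * The hyperbola through three points *)

Section Discriminant.
Variable R : comNzRingType.
Implicit Types d e : 'I_3 -> R.

Definition gap d i := d (i - 1) - d (i + 1).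

(** Twice the signed area of the triangle with vertices (d_i, e_i). *)
Definition area d e := \sum_i d i * (e (i + 1) - e (i - 1)).

(** Nonvanishing of this polynomial collects all the genericity that is used: the
points (d_i, e_i) are not collinear, and d, e and d - e are injective. *)
Definition discriminant d e :=
  area d e * \prod_i (gap d i * gap e i * gap (fun j => d j - e j) i).

Lemma gap_next d i : gap d (i + 1) = d i - d (i - 1).
Proof. by rewrite /gap addrK next_next. Qed.

Lemma gap_prev d i : gap d (i - 1) = d (i + 1) - d i.
Proof. by rewrite /gap prev_prev subrK. Qed.

Lemma areaE i d e : area d e =
  d i * (e (i + 1) - e (i - 1)) + d (i + 1) * (e (i - 1) - e i)
  + d (i - 1) * (e i - e (i + 1)).
Proof.
by rewrite /area (@big_cyc3 _ _ _ i) /= next_next prev_prev addrK subrK addrA.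
Qed.

Lemma areaC d e : area e d = - area d e.
Proof. by rewrite !(areaE 0); ring. Qed.

End Discriminant.

Lemma nonzero_discriminant (F : fieldType) (d e : 'I_3 -> F) : discriminant d e != 0 ->
  area d e != 0 /\
  forall i, [/\ gap d i != 0, gap e i != 0 & gap (fun j => d j - e j) i != 0].
Proof.
rewrite mulf_eq0 negb_or => /andP[-> /prodf_neq0 H]; split=> // i.
by move: (H i isT); rewrite !mulf_eq0 !negb_or -andbA => /and3P.
Qed.

(** Lets the discriminant of the generic matrix of indeterminates serve as the
polynomial defining the exceptional set. *)
Lemma rmorph_discriminant (R S : comNzRingType) (phi : {rmorphism R -> S})
    (d e : 'I_3 -> R) :
  phi (discriminant d e) = discriminant (phi \o d) (phi \o e).
Proof.
rewrite /discriminant /area rmorphM rmorph_sum rmorph_prod /gap /=.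
congr (_ * _); apply: eq_bigr => i _.
  by rewrite rmorphM rmorphB.
by rewrite !rmorphM !rmorphB.
Qed.

Lemma eq_discriminant (R : comNzRingType) (d d' e e' : 'I_3 -> R) :
  d =1 d' -> e =1 e' -> discriminant d e = discriminant d' e'.
Proof.
move=> dE eE; rewrite /discriminant /area /gap.
by congr (_ * _); apply: eq_bigr => i _; rewrite !dE !eE.
Qed.

Lemma discriminant_sample (R : comNzRingType) :
  discriminant (fun i => [:: 3; 0; 1]`_i) (fun i => [:: 2; 0; 3]`_i)
  = 1512%:R :> R.
Proof.
by rewrite /discriminant (areaE 0) (@big_cyc3 _ _ _ 0) /gap /=; ring.
Qed.

Section Hyperbola.
Variable F : fieldType.
Implicit Types d e x y : 'I_3 -> F.

(** First coordinate of the centre of the hyperbola with axis-parallel asymptotes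
through the points (d_i, e_i); the second one is center e d. *)
Definition center d e := (\sum_i gap d i * d i * e i) / area d e.
(** d_i - center d e in factored form, from which its nonvanishing is visible. *)
Definition offset d e i := gap d (i + 1) * gap d (i - 1) * gap e i / area d e.
(** The constant value of (X - center d e) (Y - center e d) on the hyperbola. *)
Definition power d e := - (\prod_i (gap d i * gap e i)) / area d e ^+ 2.
(** The value forced on x_i ^ 2 at a critical point with nonzero multiplier c. *)
Definition weight d e i :=
  - (gap (fun j => d j - e j) i * gap d i * gap e (i + 1) * gap e (i - 1))
  / area d e ^+ 2.

Lemma offset_center d e i : area d e != 0 -> d i - center d e = offset d e i.
Proof.
rewrite /center /offset => h; apply: (mulIf h); rewrite mulrBl !divfK //.
rewrite (@big_cyc3 _ _ _ i) /= !gap_next !gap_prev /gap (areaE i); ring.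
Qed.

(** Expanding [(d_i - a) (e_i - b) = c2] gives three equations that are linear in
a, b and a b - c2.  The gaps of d are orthogonal to the constants and to d, so
pairing the equations with them eliminates everything except a. *)
Lemma center_unique d e a b c2 : area d e != 0 ->
  (forall i, (d i - a) * (e i - b) = c2) -> a = center d e.
Proof.
move=> h H; apply: (mulIf h); rewrite /center divfK //.
transitivity (\sum_i gap d i * d i * e i
              - \sum_i gap d i * ((d i - a) * (e i - b) - c2)).
  rewrite !(@big_cyc3 _ _ _ 0) /= !gap_next !gap_prev /gap (areaE 0); ring.
by rewrite [X in _ - X]big1 ?subr0 // => i _; rewrite H subrr mulr0.
Qed.

Lemma offsetM d e i : offset d e i * offset e d i = power d e.
Proof.
rewrite /offset /power (areaC d) invrN (@big_cyc3 _ _ _ i) /= -exprVn.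
ring.
Qed.

Lemma sum_weight d e : area d e != 0 -> \sum_i weight d e i = 1.
Proof.
have i : 'I_3 := 0; move=> h.
apply: (mulIf (expf_neq0 2 h)); rewrite mulr_suml mul1r.
under eq_bigr do rewrite /weight divfK ?expf_neq0 //.
rewrite (@big_cyc3 _ _ _ i) /= !(next_next, prev_prev, addrK, subrK).
by rewrite !gap_next !gap_prev /gap (areaE i); ring.
Qed.

(** With the values forced at a critical point, this product is c x_i y_i.  It is
proportional to the
gaps of e - d, which sum to 0: this is why x and y are orthogonal. *)
Lemma offset_weight d e i : offset d e i * weight d e i =
  (\prod_j (gap d j * gap e j)) / area d e ^+ 3 * gap (fun j => e j - d j) i.
Proof.
rewrite /offset /weight (@big_cyc3 _ _ _ i) /= -!exprVn /gap; ring.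
Qed.

Lemma sum_gap d : \sum_i gap d i = 0.
Proof.
have i : 'I_3 := 0.
by rewrite (@big_cyc3 _ _ _ i) /= !gap_next !gap_prev /gap; ring.
Qed.

Lemma sum_offset_weight d e : \sum_i offset d e i * weight d e i = 0.
Proof.
under eq_bigr do rewrite offset_weight.
by rewrite -mulr_sumr sum_gap mulr0.
Qed.

Lemma sum_offset2_weight d e : area d e != 0 ->
  \sum_i offset d e i ^+ 2 * weight d e i = power d e.
Proof.
have j : 'I_3 := 0; move=> h.
under eq_bigr => i _.
  rewrite expr2 -mulrA offset_weight.
  have -> : offset d e i * (\prod_j (gap d j * gap e j) / area d e ^+ 3 *
                            gap (fun j => e j - d j) i) =
     power d e * - (offset d e i * gap (fun j => e j - d j) i / area d e).
    by rewrite /power -!exprVn; ring.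
over.
rewrite -mulr_sumr -[RHS]mulr1; congr (_ * _).
apply: (mulIf (expf_neq0 2 h)); rewrite mulr_suml mul1r.
under eq_bigr => i _.
  have -> : - (offset d e i * gap (fun j => e j - d j) i / area d e)
      * area d e ^+ 2
    = - (gap d (i + 1) * gap d (i - 1) * gap e i
         * gap (fun j => e j - d j) i).
    by rewrite /offset; field.
over.
rewrite (@big_cyc3 _ _ _ j) /= !(next_next, prev_prev, addrK, subrK).
by rewrite !gap_next !gap_prev /gap (areaE j); ring.
Qed.

(** The system is of Vandermonde type with nodes offset d e i, which are distinct
because their differences are those of the d_i. *)
Lemma weight_unique d e (w : 'I_3 -> F) : area d e != 0 ->
  (forall i, gap d i != 0) -> \sum_i w i = 1 -> \sum_i offset d e i * w i = 0 ->
  \sum_i offset d e i ^+ 2 * w i = power d e -> forall i, w i = weight d e i.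
Proof.
move=> h gd0 w0 w1 w2 i; apply/eqP; rewrite -subr_eq0; apply/eqP.
pose v j := w j - weight d e j.
have v0 : \sum_j v j = 0 by rewrite sumrB w0 sum_weight // subrr.
have v1 : \sum_j offset d e j * v j = 0.
  by under eq_bigr do rewrite mulrBr; rewrite sumrB w1 sum_offset_weight subrr.
have v2 : \sum_j offset d e j ^+ 2 * v j = 0.
  under eq_bigr do rewrite mulrBr.
  by rewrite sumrB w2 sum_offset2_weight // subrr.
have nz : - (gap d (i - 1) * gap d (i + 1)) != 0 by rewrite oppr_eq0 mulf_neq0.
apply: (mulfI nz); rewrite mulr0 -/(v i).
(* Lagrange interpolation: pair v with the quadratic polynomial that vanishes
   at the two nodes other than the i-th. *)
transitivity (\sum_j offset d e j ^+ 2 * v j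
  - (offset d e (i + 1) + offset d e (i - 1)) * \sum_j offset d e j * v j
  + offset d e (i + 1) * offset d e (i - 1) * \sum_j v j).
  rewrite !(@big_cyc3 _ _ _ i) /= gap_next gap_prev -!offset_center //; ring.
by rewrite v0 v1 v2 !mulr0 subrr addr0.
Qed.

Lemma nonzero_weight d e : discriminant d e != 0 ->
  [/\ power d e != 0, forall i, weight d e i != 0 & forall i, offset d e i != 0].
Proof.
move=> /nonzero_discriminant[h g0]; split=> [|i|i].
- rewrite /power mulf_neq0 ?invr_eq0 ?expf_neq0 // oppr_eq0.
  by apply/prodf_neq0 => i _; case: (g0 i) => *; rewrite mulf_neq0.
- rewrite /weight mulf_neq0 ?invr_eq0 ?expf_neq0 // oppr_eq0.
  case: (g0 i) (g0 (i + 1)) (g0 (i - 1)) => ? ? ? [? ? ?] [? ? ?].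
  by rewrite !mulf_neq0.
case: (g0 i) (g0 (i + 1)) (g0 (i - 1)) => ? ? ? [? ? ?] [? ? ?].
by rewrite /offset !mulf_neq0 ?invr_eq0.
Qed.

End Hyperbola.

(** * Classification of the solutions *)

Section Classification.
Variable F : fieldType.
Implicit Types (d e x y : 'I_3 -> F) (i j : 'I_3).

Definition signed_axis (b : bool) i j : F := (-1) ^+ b * (j == i)%:R.

Lemma sum_signed_axis b i (f : 'I_3 -> F) :
  \sum_j signed_axis b i j * f j = (-1) ^+ b * f i.
Proof.
rewrite (bigD1 i) //= big1 => [|j /negPf ji].
  by rewrite /signed_axis eqxx mulr1 addr0.
by rewrite /signed_axis ji mulr0 mul0r.
Qed.

Lemma signed_axis_sqr b i j : signed_axis b i j ^+ 2 = (j == i)%:R.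
Proof. by rewrite exprMn sqrr_sign mul1r; case: eqP; rewrite ?expr1n ?expr0n. Qed.

Lemma signed_axis_critical d e b b' i i' : i != i' ->
  critical_equations d e (signed_axis b i) (signed_axis b' i').
Proof.
move=> ii'; have norm1 s k : \sum_j signed_axis s k j ^+ 2 = 1.
  under eq_bigr do rewrite expr2.
  by rewrite sum_signed_axis /signed_axis eqxx mulr1 -expr2 sqrr_sign.
split=> //; first by rewrite sum_signed_axis /signed_axis (negPf ii') !mulr0.
exists (d i), (e i'), 0 => j; rewrite /signed_axis !mul0r addr0 add0r.
by split; case: eqP => [->|_]; rewrite ?mulr0.
Qed.

Lemma eigenvector_signed_axis d x a : (forall i, gap d i != 0) ->
  (forall i, d i * x i = a * x i) -> \sum_i x i ^+ 2 = 1 ->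
  exists b i, x =1 signed_axis b i.
Proof.
move=> gd0 H norm1.
have [i xi0] : exists i, x i != 0.
  apply/existsP; apply: contraT => /existsPn H0; move: norm1.
  rewrite big1 => [|i _]; first by move/eqP; rewrite eq_sym oner_eq0.
  by have := H0 i; rewrite negbK => /eqP ->; rewrite expr0n.
have dia : d i = a by apply: (mulIf xi0); apply: H.
have others j : d j - d i != 0 -> x j = 0.
  move=> dji; apply: (mulfI dji); rewrite mulr0 dia mulrBl.
  by rewrite H subrr.
have xn : x (i + 1) = 0.
  by apply: others; move: (gd0 (i - 1)); rewrite gap_prev.
have xp : x (i - 1) = 0.
  by apply: others; rewrite -oppr_eq0 opprB; move: (gd0 (i + 1)); rewrite gap_next.
move: norm1; rewrite (@big_cyc3 _ _ _ i) /= xn xp expr0n !addr0.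
move/eqP; rewrite sqrf_eq1 => /orP xi.
exists (x i == -1), i => j; rewrite /signed_axis.
case: (cyc3 i j) => ->; last 2 first.
- by rewrite xn -(subr_eq0 (i + 1)) (addrC i) addrK oner_eq0 mulr0.
- by rewrite xp -(subr_eq0 (i - 1)) (addrC i) addrK oppr_eq0 oner_eq0 mulr0.
rewrite eqxx mulr1; case: (eqVneq (x i) (-1)) xi => [-> //|_ [/eqP -> //|//]].
Qed.

(** When c is nonzero, x_i and y_i vanish together.  The products x_j y_j sum to 0
and so do their multiples by d_j - e_j, because c occurs in both eigenvector
equations.  If one product vanishes, the other two satisfy two independent
homogeneous equations, hence also vanish and x = 0. *)
Lemma coordinates_nonzero d e x y a b c :
  (forall i, gap (fun j => d j - e j) i != 0) -> c != 0 ->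
  \sum_i x i ^+ 2 = 1 -> \sum_i x i * y i = 0 -> \sum_i y i ^+ 2 = 1 ->
  (forall i, d i * x i = a * x i + c * y i /\ e i * y i = c * x i + b * y i) ->
  forall i, x i != 0.
Proof.
move=> g0 c0 xx xy yy H i; apply/negP => /eqP xi0.
have x0y j : x j * y j = 0 -> x j = 0.
  move=> /eqP; rewrite mulf_eq0 => /orP[/eqP //|/eqP yj0]; apply: (mulfI c0).
  by have [_] := H j; rewrite yj0 !mulr0 addr0 => <-.
have dexy : \sum_j (d j - e j) * (x j * y j) = 0.
  transitivity (\sum_j (a * (x j * y j) + c * y j ^+ 2
                         - (c * x j ^+ 2 + b * (x j * y j)))).
    apply: eq_bigr => j _; have [Hd He] := H j.
    have -> : (d j - e j) * (x j * y j) = d j * x j * y j - x j * (e j * y j).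
      by ring.
    by rewrite Hd He; ring.
  rewrite sumrB !big_split /= -!mulr_sumr xx xy yy; ring.
have u1 : x (i + 1) * y (i + 1) = 0.
  apply: (mulfI (g0 i)); rewrite mulr0.
  transitivity ((d (i - 1) - e (i - 1)) * \sum_j x j * y j
                - \sum_j (d j - e j) * (x j * y j)).
    by rewrite !(@big_cyc3 _ _ _ i) /= xi0 /gap; ring.
  by rewrite xy dexy mulr0 subrr.
have u2 : x (i - 1) * y (i - 1) = 0.
  by move: xy; rewrite (@big_cyc3 _ _ _ i) /= xi0 u1 mul0r !add0r.
move: xx; rewrite (@big_cyc3 _ _ _ i) /= xi0 (x0y _ u1) (x0y _ u2) expr0n !addr0.
by move/eqP; rewrite eq_sym oner_eq0.
Qed.

Definition hyperbola_equations d e x y c : Prop :=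
  c ^+ 2 = power d e /\
  forall i, x i ^+ 2 = weight d e i /\ y i = offset d e i / c * x i.

Lemma hyperbola_critical d e x y c : discriminant d e != 0 ->
  hyperbola_equations d e x y c -> critical_equations d e x y.
Proof.
move=> D0 [c2 H]; have [h _] := nonzero_discriminant D0.
have [p0 _ _] := nonzero_weight D0.
have h' : area e d != 0 by rewrite areaC oppr_eq0.
have c0 : c != 0 by rewrite -sqrf_eq0 c2.
split.
- by under eq_bigr do rewrite (H _).1; apply: sum_weight.
- transitivity (c^-1 * \sum_i offset d e i * weight d e i); last first.
    by rewrite sum_offset_weight mulr0.
  rewrite mulr_sumr; apply: eq_bigr => i _; rewrite -(H i).1 (H i).2; ring.
- transitivity (c ^- 2 * \sum_i offset d e i ^+ 2 * weight d e i); last first.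
    by rewrite sum_offset2_weight // -c2 mulVf // expf_neq0.
  rewrite mulr_sumr; apply: eq_bigr => i _; rewrite -(H i).1 (H i).2; field.
  exact: c0.
exists (center d e), (center e d), c => i; rewrite (H i).2; split.
  by rewrite mulrA [c * _]mulrC divfK // -offset_center // -mulrDl addrC subrK.
apply/eqP; rewrite -subr_eq -mulrBl offset_center // mulrA mulrA.
by rewrite [offset e d i * _]mulrC offsetM -c2 expr2 mulfK.
Qed.

(** The alternative is decided by whether the shared multiplier c vanishes. *)
Lemma critical_classification d e x y : discriminant d e != 0 ->
  critical_equations d e x y ->
  (exists b b' i i', [/\ i != i', x =1 signed_axis b i & y =1 signed_axis b' i'])
  \/ exists c, hyperbola_equations d e x y c.
Proof.
move=> /nonzero_discriminant[h g0] [xx xy yy [a [b [c H]]]].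
have gd0 i : gap d i != 0 by case: (g0 i).
have ge0 i : gap e i != 0 by case: (g0 i).
have gde0 i : gap (fun j => d j - e j) i != 0 by case: (g0 i).
case: (eqVneq c 0) => [c0|c0]; [left|right].
  have [|s [i xE]] := @eigenvector_signed_axis d x a gd0 _ xx.
    by move=> i; rewrite (H i).1 c0 mul0r addr0.
  have [|s' [i' yE]] := @eigenvector_signed_axis e y b ge0 _ yy.
    by move=> j; rewrite (H j).2 c0 mul0r add0r.
  exists s, s', i, i'; split=> //; apply/eqP => ii'; move: xy.
  under eq_bigr do rewrite xE yE.
  rewrite sum_signed_axis /signed_axis ii' eqxx mulr1 -signr_addb => /eqP.
  by rewrite signr_eq0.
have x0 := coordinates_nonzero gde0 c0 xx xy yy H.
have xcy i : (d i - a) * x i = c * y i by rewrite mulrBl (H i).1 addrC addKr.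
have prodE i : (d i - a) * (e i - b) = c ^+ 2.
  apply: (mulIf (x0 i)); rewrite mulrAC xcy -mulrA [y i * _]mulrC mulrBl.
  by rewrite (H i).2 addrK mulrA -expr2.
have aE : a = center d e := center_unique h prodE.
have bE : b = center e d.
  apply: (@center_unique _ e d b a (c ^+ 2)) => [|i]; last by rewrite mulrC.
  by rewrite areaC oppr_eq0.
have dE i : d i - a = offset d e i by rewrite aE offset_center.
have c2 : c ^+ 2 = power d e.
  rewrite -(prodE 0) -(offsetM d e 0) aE bE !offset_center //.
  by rewrite areaC oppr_eq0.
have yE i : y i = offset d e i / c * x i.
  by apply: (mulfI c0); rewrite -xcy dE mulrA [c * _]mulrC divfK.
exists c; split=> // i; split; last exact: yE.
apply: (weight_unique (w := fun j => x j ^+ 2)) => //.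
  transitivity (c * \sum_j x j * y j); last by rewrite xy mulr0.
  by rewrite mulr_sumr; apply: eq_bigr => j _; rewrite yE; field.
transitivity (c ^+ 2 * \sum_j y j ^+ 2); last by rewrite yy mulr1.
by rewrite mulr_sumr; apply: eq_bigr => j _; rewrite yE; field.
Qed.

End Classification.

(** * Counting *)

Section Count.
Variable C : numClosedFieldType.
Implicit Types (d e x y : 'I_3 -> C).

Definition frame x y : 'M[C]_(3, 2) :=
  \matrix_(i, j) if j == 0 then x i else y i.

Lemma eq_critical_equations d e x x' y y' : x =1 x' -> y =1 y' ->
  critical_equations d e x y -> critical_equations d e x' y'.
Proof.
move=> ex ey [xx xy yy [a [b [c H]]]]; split.
- by under eq_bigr do rewrite -ex.
- by under eq_bigr do rewrite -ex -ey.
- by under eq_bigr do rewrite -ey.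
by exists a, b, c => i; rewrite -ex -ey.
Qed.

Lemma critical_frame (d e : 'rV[C]_3) x y :
  critical_point (diag_mx d) (diag_mx e) (frame x y) <->
  critical_equations (d 0) (e 0) x y.
Proof.
have two0 : 2 != 0 :> C by rewrite pnatr_eq0.
rewrite (critical_pointP _ _ _ two0).
by split; apply: eq_critical_equations => i; rewrite mxE.
Qed.

Lemma frame_eq x y x' y' : frame x y = frame x' y' -> x =1 x' /\ y =1 y'.
Proof.
by move=> /matrixP E; split=> i; [have := E i 0|have := E i 1]; rewrite !mxE.
Qed.

Lemma frame_cols (Z : 'M[C]_(3, 2)) x y :
  Z^~ 0 =1 x -> Z^~ 1 =1 y -> Z = frame x y.
Proof.
by move=> Z0 Z1; apply/matrixP => i; apply: ord2P; rewrite mxE /= -?Z0 -?Z1.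
Qed.

(** The lift of k avoids i, so these tuples index the ordered pairs of orthogonal
signed coordinate vectors without repetition. *)
Definition axis_frame (t : bool * bool * 'I_3 * 'I_2) : 'M[C]_(3, 2) :=
  let: (b, b', i, k) := t in
  frame (signed_axis C b i) (signed_axis C b' (lift i k)).

(** The four sign choices are those of the coordinates of x and of the shared
multiplier c, a square root of power d e; y is then determined. *)
Definition hyperbola_frame d e (t : {ffun 'I_3 -> bool} * bool) : 'M[C]_(3, 2) :=
  let x i := (-1) ^+ t.1 i * sqrtC (weight d e i) in
  frame x (fun i => offset d e i / ((-1) ^+ t.2 * sqrtC (power d e)) * x i).

Lemma signed_axis_inj b b' i i' :
  signed_axis C b i =1 signed_axis C b' i' -> b = b' /\ i = i'.
Proof.
move=> /(_ i); rewrite /signed_axis eqxx mulr1; case: eqP => [<-|_].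
  by rewrite mulr1 => /signr_inj.
by move/eqP; rewrite mulr0 signr_eq0.
Qed.

Lemma axis_frame_inj : injective axis_frame.
Proof.
move=> [[[b b'] i] k] [[[c c'] j] l] /frame_eq[].
by move=> /signed_axis_inj[-> ->] /signed_axis_inj[-> /lift_inj ->].
Qed.

Lemma hyperbola_frame_inj d e : discriminant d e != 0 ->
  injective (hyperbola_frame d e).
Proof.
move=> /nonzero_weight[p0 w0 o0] [s t] [s' t'] /frame_eq[/= Ex Ey].
have sE : s = s'.
  apply/ffunP => i; apply: (@signr_inj C).
  by apply: (mulIf _ (Ex i)); rewrite sqrtC_eq0.
have x0 : (-1) ^+ s' 0 * sqrtC (weight d e 0) != 0.
  by rewrite mulf_neq0 ?signr_eq0 ?sqrtC_eq0.
have c0 : sqrtC (power d e) != 0 by rewrite sqrtC_eq0.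
move: (Ey 0); rewrite sE => /(mulIf x0)/(mulfI (o0 _))/invr_inj/(mulIf c0).
by move/signr_inj => ->.
Qed.

Lemma axis_hyperbola_disjoint d e t u : discriminant d e != 0 ->
  axis_frame t != hyperbola_frame d e u.
Proof.
case: t => [[[b b'] i] k] /nonzero_weight[_ w0 _].
(* The first column of an axis frame has a zero entry. *)
apply/eqP => /frame_eq[/(_ (lift i k)) /eqP + _].
rewrite /signed_axis eq_sym [_ == i]eq_sym (negPf (neq_lift i k)) mulr0.
by rewrite mulf_eq0 signr_eq0 sqrtC_eq0 (negPf (w0 _)).
Qed.

Lemma algebraic_degree_40 (d e : 'rV[C]_3) : discriminant (d 0) (e 0) != 0 ->
  algebraic_degree_is (diag_mx d) (diag_mx e) 40.
Proof.
move=> D0; have two0 : 2 != 0 :> C by rewrite pnatr_eq0.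
exists (codom axis_frame ++ codom (hyperbola_frame (d 0) (e 0))); split.
- rewrite cat_uniq; apply/and3P; split; first exact/injectiveP/axis_frame_inj.
    apply/hasPn => _ /codomP[u ->]; apply/negP => /codomP[t] /esym/eqP.
    exact/negP/axis_hyperbola_disjoint.
  exact/injectiveP/hyperbola_frame_inj.
- by rewrite size_cat !size_codom !card_prod card_ffun !card_bool !card_ord.
move=> Z; rewrite mem_cat; split=> [/orP[]/codomP|].
- move=> [[[[b b'] i] k] ->]; apply/critical_frame.
  exact: signed_axis_critical (neq_lift _ _).
- move=> [[s t] ->]; apply/critical_frame.
  apply: (hyperbola_critical (c := (-1) ^+ t * sqrtC (power (d 0) (e 0)))) => //.
  split; first by rewrite exprMn sqrr_sign mul1r sqrtCK.
  by move=> i; rewrite /= exprMn sqrr_sign mul1r sqrtCK.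
move=> /(critical_pointP _ _ _ two0) /(critical_classification D0) [].
  move=> [b [b' [i [i' [/unlift_some[k -> _] Z0 Z1]]]]]; apply/orP; left.
  by apply/codomP; exists (b, b', i, k); apply: frame_cols.
move=> [c [c2 H]]; apply/orP; right; apply/codomP.
have signE (z w : C) : z ^+ 2 = w -> z = (-1) ^+ (z != sqrtC w) * sqrtC w.
  move=> zw; have : z ^+ 2 == sqrtC w ^+ 2 by rewrite sqrtCK zw.
  by rewrite eqf_sqr; case: eqP => [-> _|_ /eqP ->]; rewrite ?mul1r // mulN1r.
pose s := [ffun i => Z i 0 != sqrtC (weight (d 0) (e 0) i)].
exists (s, c != sqrtC (power (d 0) (e 0))).
have xE i : Z i 0 = (-1) ^+ s i * sqrtC (weight (d 0) (e 0) i).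
  by rewrite ffunE; apply: signE; case: (H i).
apply: frame_cols => i /=; first exact: xE.
by rewrite -(signE _ _ c2) -xE; case: (H i).
Qed.
End Count.

(** * Genericity *)

Theorem proposition4p2 (R : realType) :
  generically (fun a : 'M[R[i]]_(2, 3) =>
    algebraic_degree_is (diag_mx (row 0 a)) (diag_mx (row 1 a)) 40).
Proof.
pose f : {mpoly R[i][2 * 3]} :=
  discriminant (indet_mx _ 2 3 0) (indet_mx _ 2 3 1).
have fE a : eval_at f a = discriminant (a 0) (a 1).
  rewrite /eval_at /f rmorph_discriminant.
  by apply: eq_discriminant => i; apply: eval_indet.
exists (fun a => eval_at f a = 0); split.
- exists (eq f) => a; split=> [fa _ <- //|]; exact.
- exists (\matrix_(i, j) (if i == 0 then [:: 3; 0; 1] else [:: 2; 0; 3])`_j).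
  rewrite fE (eq_discriminant (fun j => mxE _ _ _ j) (fun j => mxE _ _ _ j)).
  by rewrite discriminant_sample; apply/eqP; rewrite pnatr_eq0.
move=> a /eqP; rewrite fE => D0; apply: algebraic_degree_40.
by rewrite (eq_discriminant (d' := a 0) (e' := a 1)) // => i; rewrite mxE.
Qed.
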